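(* Let $G=\{x_0,x_1,\dots,x_{n-1}\}$ be a finite abelian group of order $n$, and let $p(G)$ be the number of formally different monomials occurring in the permanent $\mathrm{per}(M_G)$ of the Cayley table of $G$. Then $$p(G)=\dim (S^nR)^G,$$ where $R$ is the regular representation of $G$ over $\mathbb C$.
   Context: The group operation of $G$ is denoted $\dotplus$. The elements $x_0,\dots,x_{n-1}$ of $G$ are also regarded as independent variables of the polynomial ring $\mathbb C[x_0,\dots,x_{n-1}]$. The Cayley table of $G$ is the $n\times n$ matrix $M_G=(m_{i,j})_{0\le i,j\le n-1}$ with entries $m_{i,j}=x_i\dotplus x_j$, i.e. $m_{i,j}$ is the variable corresponding to the group element $x_i\dotplus x_j$. Its permanent is $\mathrm{per}(M_G)=\sum_{\pi}\prod_{i=0}^{n-1}m_{i,\pi(i)}$, the sum over all permutations $\pi$ of $\{0,\dots,n-1\}$. A monomial occurs in a polynomial if its coefficient is nonzero. $S^nR$ is the $n$-th symmetric power of $R$ and $(S^nR)^G$ its subspace of $G$-invariants. *)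

(* Defs.v *)
From mathcomp Require Import all_boot all_fingroup all_algebra.
From mathcomp Require Import mxrepresentation.
From mathcomp Require Import mpoly.

Set Implicit Arguments.
Unset Strict Implicit.
Unset Printing Implicit Defensive.

Import GroupScope GRing.Theory.
Local Open Scope ring_scope.

Definition permanent (A : comNzRingType) (n : nat) (M : 'M[A]_n) : A :=
  \sum_(s : 'S_n) \prod_(i < n) M i (s i).

(* The polynomial variables are the elements of G, numbered by gring_index,
   which is also the numbering of the basis of regular_repr; x is an arbitrary
   enumeration of G, which orders the rows and columns. *)
Definition cayley_mx (F : comNzRingType) (gT : finGroupType) (G : {group gT})
    (n : nat) (x : 'I_n -> gT) : 'M[{mpoly F[#|G|]}]_n :=
  \matrix_(i, j) 'X_(gring_index G (x i * x j)%g).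

Definition num_monomials (F : nzRingType) (m : nat) (p : {mpoly F[m]}) : nat :=
  size (msupp p).

Section SymmetricPower.

Variables (F : fieldType) (gT : finGroupType) (G : {group gT}) (m : nat).
Variables (rG : mx_representation F G m) (d : nat).

(* With (e_i) the standard basis of V = F^m, the d-th tensor power of V has
   the basis e_(f 0) (x) ... (x) e_(f (d-1)), for f : 'I_m ^ d. *)
Notation tens_index := {ffun 'I_d -> 'I_m}.

Definition tens_basis (f : tens_index) : 'rV[F]_#|tens_index| :=
  delta_mx 0 (enum_rank f).

Definition tens_mx (g : gT) : 'M[F]_#|tens_index| :=
  \matrix_(a, b) \prod_(k < d) rG g ((enum_val a : tens_index) k) ((enum_val b : tens_index) k).

Lemma tens_basisM f g : tens_basis f *m tens_mx g =
  \sum_(h : tens_index) (\prod_k rG g (f k) (h k)) *: tens_basis h.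
Proof.
rewrite -rowE; apply/rowP=> b; rewrite !mxE summxE (bigD1 (enum_val b)) //=.
rewrite !mxE enum_valK !eqxx mulr1 [X in _ + X]big1 ?addr0.
  by apply: eq_bigr => k _; rewrite enum_rankK.
move=> h hb; rewrite !mxE /= [b == _]eq_sym.
by rewrite -(inj_eq enum_val_inj) enum_rankK (negPf hb) mulr0.
Qed.

Lemma tens_mx_repr : mx_repr G tens_mx.
Proof.
split=> [|g h Gg Gh].
  apply/matrixP=> a b; rewrite !mxE repr_mx1.
  case: (altP (a =P b)) => [-> | neq_ab].
    by rewrite big1 // => k _; rewrite mxE eqxx.
  have [k neq_k | eq_ab] := pickP (fun k => (enum_val a : tens_index) k != (enum_val b : tens_index) k).
    by rewrite (bigD1 k) //= mxE (negPf neq_k) mul0r.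
  case/negP: neq_ab; apply/eqP/enum_val_inj/ffunP=> k.
  exact/eqP/negbFE/eq_ab.
apply/matrixP=> a b; rewrite !mxE repr_mxM //.
under eq_bigr => k _ do rewrite mxE.
rewrite bigA_distr_bigA /= (reindex _ (onW_bij _ (@enum_val_bij _))) /=.
by apply: eq_bigr => c _; rewrite !mxE -big_split.
Qed.

Definition tens_repr := MxRepresentation tens_mx_repr.

(* The span of the e_f - e_(f o s), s permuting the d tensor factors. *)
Definition sym_rel : 'M[F]_#|tens_index| :=
  (\sum_(f : tens_index) \sum_(s : 'S_d)
     <<tens_basis f - tens_basis [ffun k => f (s k)]>>)%MS.

Lemma sym_rel_mxmodule : mxmodule tens_repr sym_rel.
Proof.
apply/mxmoduleP=> g Gg; rewrite /sym_rel sumsmxMr; apply/sumsmx_subP=> f _.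
rewrite sumsmxMr; apply/sumsmx_subP=> s _.
rewrite (eqmxMr _ (genmxE _)) mulmxBl !tens_basisM.
have inj_s : bijective (fun h : tens_index => [ffun k => h (s k)]).
  exists (fun h : tens_index => [ffun k => h ((s^-1)%g k)]) => h;
    by apply/ffunP=> k; rewrite !ffunE ?permK ?permKV.
rewrite [X in _ - X](reindex _ (onW_bij _ inj_s)) /= -sumrB.
apply: summx_sub => h _.
have -> : \prod_k rG g ([ffun k => f (s k)] k) ([ffun k => h (s k)] k)
        = \prod_k rG g (f k) (h k).
  rewrite [RHS](reindex_inj (@perm_inj _ s)) /=.
  by apply: eq_bigr => k _; rewrite !ffunE.
rewrite -scalerBr scalemx_sub //.
by rewrite (sumsmx_sup h) // (sumsmx_sup s) // genmxE.
Qed.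

Definition sym_repr := factmod_repr sym_rel_mxmodule.

End SymmetricPower.

(* Main.v *)
Require Import Defs.
From mathcomp Require Import all_boot all_fingroup all_algebra mxrepresentation.
From mathcomp Require Import complex reals mpoly.
From mathcomp Require Import all_order all_solvable all_field.

(** A monomial occurs in the permanent iff it is the product of the variables
    [x_i + x_s(i)] for some permutation [s]. The sum of these elements is twice
    the sum of [G], that is 0, and by a theorem of M. Hall (1952) every multiset
    of [n] elements of [G] of sum 0 arises in this way. So the left-hand side
    counts the zero-sum multisets of [n] elements of [G].

    For the right-hand side, identify [G] with its dual group by a nondegenerate
    pairing [B : G x G -> C^*]. The vectors [v_g = sum_h B(g,h) e_h] form an
    eigenbasis of the regular representation, so the degree [n] monomials in the
    [v_g] form an eigenbasis of its [n]-th symmetric power, and such a monomial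
    is invariant iff its indices sum to 0. *)

Set Implicit Arguments.
Unset Strict Implicit.
Unset Printing Implicit Defensive.

Import GroupScope.

(** * Hall's theorem *)

Section Hall.

Variables (gT : finGroupType) (G : {group gT}).
Hypothesis abG : abelian G.

Let mulGC : {in G &, commutative (fun x y : gT => x * y)}.
Proof. by move=> x y Gx Gy; apply: (centsP abG). Qed.

Definition enumerates (I : finType) (a : I -> gT) :=
  injective a /\ forall i, a i \in G.

Lemma enumerates_perm (I : finType) (a : I -> gT) (s : {perm I}) :
  enumerates a -> enumerates (a \o s).
Proof.
by case=> inj_a Ga; split=> [|i]; [apply: inj_comp => //; apply: perm_inj|apply: Ga].
Qed.

(** By cardinality [c] is onto [G], so [t] can be [c^-1] after [a]. *)
Lemma enumerates_transport (I : finType) (a c : I -> gT) :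
  #|I| = #|G| -> enumerates a -> enumerates c ->
  exists t : {perm I}, forall i, c (t i) = a i.
Proof.
move=> cardI [inj_a Ga] [inj_c Gc].
have imc : c @: I = G.
  apply/eqP; rewrite eqEcard card_imset // cardI leqnn andbT.
  by apply/subsetP=> _ /imsetP[i _ ->].
have sol i : exists k, c k == a i.
  by have := Ga i; rewrite -imc => /imsetP[k _ ->]; exists k.
pose t i := xchoose (sol i).
have tE i : c (t i) = a i by apply/eqP/(xchooseP (sol i)).
have inj_t : injective t by move=> i j eq_t; apply: inj_a; rewrite -!tE eq_t.
by exists (perm inj_t) => i; rewrite permE.
Qed.

Section Exchange.

Variables (I : finType) (i j : I) (a c b : I -> gT).
Hypotheses (Ea : enumerates a) (Ec : enumerates c) (Gb : forall k, b k \in G).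
Hypothesis bE : forall k, k != i -> k != j -> c k = a k * b k.
Hypothesis bijE : c i * c j = a i * a j * (b i * b j).

Let K := a i * a j * b i.

(* Along the [t]-orbit of [j] the quotient [b k] is preserved when [a] is
   shifted backwards and [c] forwards, because [c (t k) * a k = K]. *)
Lemma exchange_orbit (t : {perm I}) :
    (forall k, c (t k) = K * (a k)^-1) -> i \notin porbit t j ->
  exists a' c', [/\ enumerates a', enumerates c' & forall k, c' k = a' k * b k].
Proof.
move=> tE i_notin; have [[_ Ga] [_ Gc]] := (Ea, Ec).
set O := porbit t j in i_notin; have Oj : j \in O by apply: porbit_id.
have Ot k : (t k \in O) = (k \in O).
  by rewrite -!eq_porbit_mem -(porbit_perm t 1 k) expg1.
have OtV k : (t^-1 k \in O) = (k \in O) by rewrite -Ot permKV.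
have nO : t \in 'N(O | 'P) by apply/astabsP=> k; apply: Ot.
pose w := restr_perm O t.
have wO k : k \in O -> w k = t k by move=> Ok; rewrite restr_permE.
have wnO k : k \notin O -> w k = k by apply/out_perm/restr_perm_on.
have wVO k : k \in O -> w^-1 k = t^-1 k.
  by move=> Ok; apply: (@perm_inj _ w); rewrite permKV wO ?permKV ?OtV.
have wVnO k : k \notin O -> w^-1 k = k.
  by move=> Ok; apply: (@perm_inj _ w); rewrite permKV wnO.
(* The transposition matters only at [i] and [j]. The new [c] at [i] is
   [c (t j) = K * (a j)^-1 = a i * b i]. At [j] it is [c i], facing [a (t^-1 j) = K * (c j)^-1]; the
   quotient is [b j] because [bijE] reads [c i * c j = K * b j]. *)
exists (a \o w^-1), ((c \o w) \o tperm i j).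
split; try by do ?apply: enumerates_perm.
have GK : K \in G by rewrite !groupM.
have KE k : K = c k * a (t^-1 k) by rewrite -[in c k](permKV t k) tE mulgKV.
move=> k /=; have [-> | k_i] := eqVneq k i.
  rewrite tpermL wO // wVnO // tE /K -!mulgA.
  by rewrite (mulgA (a j)) (mulGC (Ga j) (Gb i)) mulgK.
have [-> | k_j] := eqVneq k j.
  rewrite tpermR wnO // wVO //; apply: (mulIg (c j)).
  by rewrite bijE mulgA -/K (KE j) -!mulgA mulGC ?groupM // -mulgA.
rewrite tpermD 1?eq_sym //; have [Ok | nOk] := boolP (k \in O); last first.
  by rewrite wnO // wVnO // bE.
rewrite wO // wVO // tE (KE k) bE // mulGC ?groupM ?groupV //.
by rewrite !mulgA mulVg mul1g mulGC.
Qed.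

End Exchange.

(* If [i] lies on the orbit of [j], exchanging the values of [c] at [i] and [j]
   cuts the orbit just before [i]. *)
Lemma exchange (I : finType) (i j : I) (a c b : I -> gT) :
    #|I| = #|G| -> i != j -> enumerates a -> enumerates c ->
    (forall k, b k \in G) ->
    (forall k, k != i -> k != j -> c k = a k * b k) ->
    c i * c j = a i * a j * (b i * b j) ->
  exists a' c', [/\ enumerates a', enumerates c' & forall k, c' k = a' k * b k].
Proof.
move=> cardI neq_ij Ea Ec Gb bE bijE; have [[inj_a Ga] [_ Gc]] := (Ea, Ec).
pose K := a i * a j * b i; have GK : K \in G by rewrite !groupM.
have EKa : enumerates (fun k => K * (a k)^-1).
  split=> [k l /mulgI/invg_inj/inj_a // | k].
  by rewrite groupM ?groupV.
have [t tE] := enumerates_transport cardI EKa Ec.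
have [i_in | i_notin] := boolP (i \in porbit t j); last first.
  exact: exchange_orbit tE i_notin.
pose u := tperm i j.
apply: (@exchange_orbit I i j a (c \o u) b Ea _ Gb _ _ (t * u)).
- exact: enumerates_perm.
- by move=> k k_i k_j /=; rewrite tpermD 1?eq_sym ?bE.
- by rewrite /= tpermL tpermR mulGC.
- by move=> k; rewrite /= permM tpermK tE.
have [m /eqP ti tmin] := ex_minnP (let: ex_intro m e := porbitP _ _ _ i_in in
  ex_intro (fun m => i == (t ^+ m) j) m (introT eqP e)).
have m_gt0 : 0 < m.
  by rewrite lt0n; apply: contraNneq neq_ij => m0; rewrite ti m0 perm1.
have tN l : l < m -> (t ^+ l) j != i.
  by move=> lm; apply: contraTneq lm => e; rewrite -leqNgt tmin // -e.
pose v := t * u.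
(* The [v]-orbit of [j] follows [t] until it would first meet [i], at step [m]; there [u] sends it
   back to [j]. *)
have vE l : exists2 l', l' < m & (v ^+ l) j = (t ^+ l') j.
  elim: l => [|l [l' l'm IHl]]; first by exists 0; rewrite ?perm1.
  rewrite expgSr permM IHl.
  have -> : v ((t ^+ l') j) = u ((t ^+ l'.+1) j) by rewrite expgSr !permM.
  have [l'1m | ml'1] := ltnP l'.+1 m; last first.
    exists 0 => //; have -> : l'.+1 = m by apply/eqP; rewrite eqn_leq l'm.
    by rewrite -ti tpermL perm1.
  have [tj | tNj] := eqVneq ((t ^+ l'.+1) j) j; last first.
    by exists l'.+1; rewrite // tpermD // eq_sym ?tN.
  (* A return to [j] before step [m] would make [i] reachable from [j] in [m - l'.+1] steps, against
     the minimality of [m]. *)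
  have /negP[] : (t ^+ (m - l'.+1)) j != i by rewrite tN // ltn_subrL.
  by rewrite ti -{2}(subnKC (ltnW l'1m)) expgD permM tj.
apply/porbitP=> -[l il]; have [l' l'm e] := vE l.
by have /eqP[] := tN l' l'm; rewrite -e.
Qed.

Lemma hall_quotients (n : nat) (b : 'I_n -> gT) :
    n = #|G| -> (forall k, b k \in G) -> \prod_(k < n) b k = 1 ->
  exists a c : 'I_n -> gT,
    [/\ enumerates a, enumerates c & forall k, c k = a k * b k].
Proof.
case: n b => [|N] b cardG Gb prod_b1.
  by have := cardG_gt0 G; rewrite -cardG.
pose P m := \prod_(0 <= k < m) b (inord k).
have GP m : P m \in G by apply: group_prod.
(* Deform the constant family 1 into b one entry at a time, letting the last
   entry keep the product equal to 1. *)
pose bm m (k : 'I_N.+1) :=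
  if k < m then b k else if k == ord_max then (P m)^-1 else 1.
have Gbm m k : bm m k \in G by rewrite /bm; do 2?case: ifP; rewrite ?groupV.
suff step m : m <= N -> exists a c : 'I_N.+1 -> gT,
    [/\ enumerates a, enumerates c & forall k, c k = a k * bm m k].
  have [a [c [Ea Ec bE]]] := step N (leqnn N).
  exists a, c; split=> // k; rewrite bE /bm; case: ltnP => // Nk.
  have -> : k = ord_max by apply/val_inj/eqP; rewrite eqn_leq Nk -ltnS ltn_ord.
  rewrite eqxx; congr (_ * _); apply: (mulgI (P N)); rewrite mulgV -prod_b1.
  rewrite big_ord_recr /P big_mkord; congr (_ * _).
  by apply: eq_bigr => l _; congr b; apply/val_inj; rewrite /= inordK // ltnS ltnW.
elim: m => [_ | m IHm ltmN].
  pose a (k : 'I_N.+1) := @enum_val _ (mem G) (cast_ord cardG k).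
  have Ea : enumerates a.
    split=> [k l /enum_val_inj/cast_ord_inj // | k]; apply: enum_valP.
  exists a, a; split=> // k; rewrite /bm ltn0 /P big_geq // invg1.
  by case: ifP; rewrite mulg1.
have [a [c [Ea Ec bE]]] := IHm (ltnW ltmN).
have cardI : #|'I_N.+1| = #|G| by rewrite card_ord.
pose i : 'I_N.+1 := inord m.
have iE : i = m :> nat by rewrite inordK // ltnS ltnW.
have [_ Ga] := Ea.
apply: (@exchange _ i ord_max a c (bm m.+1) cardI) => //.
- by rewrite -val_eqE /= iE neq_ltn ltmN.
- move=> k k_i k_N; rewrite bE /bm (negPf k_N) ltnS [k <= m]leq_eqVlt.
  suff /negPf-> : (k : nat) != m by [].
  by apply: contraNneq k_i => km; apply/eqP/val_inj; rewrite /= iE.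
have Ni : (i == ord_max) = false by rewrite -val_eqE /= iE ltn_eqF.
(* Entries [m] and [N] change from [1] and [(P m)^-1] to [b i] and [(P m * b i)^-1], so their
   product is preserved. *)
rewrite !bE -!mulgA; congr (_ * _).
rewrite mulgA (mulGC (Gbm m i) (Ga ord_max)) -mulgA.
congr (_ * _).
rewrite /bm /= iE !ltnn ltnS leqnn Ni mul1g eqxx ltnNge (ltnW ltmN) /=.
rewrite ltnNge ltmN /= /P big_nat_recr //= invMg.
by rewrite mulgA -/i mulgV mul1g.
Qed.

(** In [b k = (a k)^-1 * c k] both factors run through [G] once, so each is a reordering of [x].
    Undoing the first reordering gives [r], and the second then becomes [s]. *)
Lemma hall_sum (n : nat) (x b : 'I_n -> gT) :
    n = #|G| -> enumerates x -> (forall k, b k \in G) ->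
    \prod_(k < n) b k = 1 ->
  exists s r : 'S_n, forall k, b (r k) = x k * x (s k).
Proof.
move=> nG Ex Gb prod_b1.
have cardI : #|'I_n| = #|G| by rewrite card_ord.
have [a [c [Ea Ec bE]]] := hall_quotients nG Gb prod_b1.
have EV : enumerates (fun k => (a k)^-1).
  by have [inj_a Ga] := Ea; split=> [k l /invg_inj/inj_a|k]; rewrite ?groupV.
have [t tE] := enumerates_transport cardI EV Ex.
have [u uE] := enumerates_transport cardI Ec Ex.
exists (t^-1 * u), t^-1 => k; rewrite permM uE bE -{2}[k](permKV t) tE.
by rewrite mulKg.
Qed.

End Hall.

Import GRing.Theory Num.Theory.
Local Open Scope ring_scope.

(** * Pairings of finite abelian groups *)

(** Multiplying the sum by [chi g0] only permutes its terms. *)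
Lemma sum_character_eq0 (F : fieldType) (gT : finGroupType) (G : {group gT})
    (chi : gT -> F) (g0 : gT) :
  {in G &, {morph chi : g h / (g * h)%g >-> g * h}} ->
  g0 \in G -> chi g0 != 1 -> \sum_(g in G) chi g = 0.
Proof.
move=> chiM Gg0 neq1; set S := \sum_(g in G) _.
apply/eqP; have : (chi g0 - 1) * S == 0.
  rewrite mulrBl mul1r subr_eq0 /S [X in _ == X](reindex_inj (mulgI g0)) big_distrr /=.
  by apply/eqP/eq_big => [g | g Gg]; rewrite ?groupMl ?chiM.
by rewrite mulf_eq0 subr_eq0 (negPf neq1).
Qed.

(** In characteristic 0 the polynomial [X^n - 1] is separable, so it has [n] distinct roots, and
    these must include a primitive one. *)
Lemma exists_prim_root (F : numClosedFieldType) (n : nat) :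
  (0 < n)%N -> exists z : F, n.-primitive_root z.
Proof.
move=> n_gt0; have [r Dp] := closed_field_poly_normal ('X^n - 1%:P : {poly F}).
move: Dp; rewrite lead_coefXnsubC // scale1r => Dp.
have sz_r : size r = n.
  by apply: succn_inj; rewrite -(size_XnsubC (1 : F) n_gt0) Dp size_prod_XsubC.
have /hasP[z _ zP] : has n.-primitive_root r; last by exists z.
apply: has_prim_root; rewrite ?sz_r //.
  apply/allP=> z r_z; rewrite unity_rootE -subr_eq0; move: r_z.
  by rewrite -root_prod_XsubC -Dp rootE !hornerE.
rewrite -separable_prod_XsubC -Dp; apply: cyclotomic.separable_Xn_sub_1.
by rewrite pnatr_eq0 -lt0n.
Qed.

Section PairingExistence.

Variables (F : numClosedFieldType) (gT : finGroupType).
Implicit Types (G H : {group gT}) (B : gT -> gT -> F).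

Definition pairing_on (G : {set gT}) B :=
  [/\ {in G & &, forall g h k, B (g * h)%g k = B g k * B h k},
      {in G & &, forall g h k, B g (h * k)%g = B g h * B g k},
      {in G &, forall g h, B g h != 0}
    & {in G, forall g, {in G, forall k, B g k = 1} -> g = 1%g}].

(** Take [B (x^i) (x^j) = z^(i j)] with [z] a primitive root of unity of order [#[x]]; pairing with
    [x] alone already detects [i] modulo [#[x]]. *)
Lemma pairing_cycle (x : gT) : exists B, pairing_on <[x]>%g B.
Proof.
have [z zP] := @exists_prim_root F #[x] (order_gt0 x).
(* Some discrete logarithm, with default 0 off the cycle; the successor in the bound only provides
   [ord0]. By [zE] the choice of exponent does not affect the powers of [z]. *)
pose lg g : nat := odflt ord0 [pick i : 'I_#[x].+1 | x ^+ i == g]%g.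
have lgE g : g \in <[x]>%g -> (x ^+ lg g)%g = g.
  rewrite /lg; case: pickP => [i /eqP //| no] /cyclePmin[i ltix gE].
  by have := no (Ordinal (ltnW ltix : i < #[x].+1)%N); rewrite /= gE eqxx.
have zE i j : (x ^+ i = x ^+ j)%g -> z ^+ i = z ^+ j.
  by move/eqP; rewrite eq_expg_mod_order -(eq_prim_root_expr zP) => /eqP.
have zlgM g h : g \in <[x]>%g -> h \in <[x]>%g ->
    z ^+ lg (g * h)%g = z ^+ lg g * z ^+ lg h.
  by move=> Xg Xh; rewrite -exprD; apply: zE; rewrite expgD !lgE // groupM.
exists (fun g h => z ^+ (lg g * lg h)); split.
- by move=> g h k Xg Xh Xk; rewrite !exprM zlgM // exprMn.
- by move=> g h k Xg Xh Xk; rewrite !(mulnC (lg g)) !exprM zlgM // exprMn.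
- move=> g h _ _; rewrite expf_neq0 //; apply: contra_eq_neq (prim_expr_order zP).
  by move=> ->; rewrite expr0n gtn_eqF ?order_gt0 // eq_sym oner_eq0.
move=> g Xg /(_ x (cycle_id x)).
rewrite mulnC exprM (_ : z ^+ lg x = z) => [|]; last first.
  by rewrite -[RHS]expr1; apply: zE; rewrite lgE ?cycle_id ?expg1.
by move/eqP; rewrite -(prim_order_dvd zP) order_dvdn lgE // => /eqP.
Qed.

Lemma pairing_1l G B h : pairing_on G B -> h \in G -> B 1%g h = 1.
Proof.
case=> Bl _ B0 _ Gh; apply: (mulIf (B0 1%g h (group1 G) Gh)).
by rewrite -Bl // mulg1 mul1r.
Qed.

Lemma pairing_1r G B g : pairing_on G B -> g \in G -> B g 1%g = 1.
Proof.
case=> _ Br B0 _ Gg; apply: (mulIf (B0 g 1%g Gg (group1 G))).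
by rewrite -Br // mulg1 mul1r.
Qed.

(** Multiply the pairings of the two components. Testing against [A] and against [B] separately
    shows that both components of a degenerate element are trivial. *)
Lemma pairing_dprod (A B G : {group gT}) bA bB :
  A \x B = G -> pairing_on A bA -> pairing_on B bB ->
  exists bG, pairing_on G bG.
Proof.
move=> defG PA PB; have [[Al Ar A0 An] [Bl Br B0 Bn]] := (PA, PB).
have [_ defM cAB tiAB] := dprodP defG.
have [nAG _] := dprod_normal2 defG.
have compl : B \in [complements to A in G].
  by apply/complP; split=> //; rewrite defM.
pose p := divgr A B; pose q := remgr A B.
have pM : {in G &, {morph p : x y / (x * y)%g}} by apply: divgrM compl _.
have qM : {in G &, {morph q : x y / (x * y)%g}} by apply: remgrM compl _.
have Ap g : g \in G -> p g \in A by rewrite -defM; apply: mem_divgr.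
have Bq g : g \in G -> q g \in B by rewrite -defM; apply: mem_remgr.
have sAG g : g \in A -> g \in G by apply/subsetP/(normal_sub nAG).
have sBG g : g \in B -> g \in G.
  by move=> Bg; rewrite -defM -[g]mul1g mem_mulg.
exists (fun g h => bA (p g) (p h) * bB (q g) (q h)); split.
- by move=> g h k Gg Gh Gk; rewrite pM // qM // Al ?Ap // Bl ?Bq // mulrACA.
- by move=> g h k Gg Gh Gk; rewrite pM // qM // Ar ?Ap // Br ?Bq // mulrACA.
- by move=> g h Gg Gh; rewrite mulf_neq0 ?A0 ?B0 ?Ap ?Bq.
move=> g Gg Pg.
have p1 : p g = 1%g.
  apply: An (Ap g Gg) _ => k Ak; rewrite -(Pg k (sAG k Ak)).
  have -> : p k = k by apply: divgr_id.
  have -> : q k = 1%g by apply: remgr1.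
  by rewrite (pairing_1r PB) ?Bq ?mulr1.
have q1 : q g = 1%g.
  apply: Bn (Bq g Gg) _ => k Bk; rewrite -(Pg k (sBG k Bk)).
  have -> : p k = 1%g by rewrite /p -[k]mul1g divgrMid.
  have -> : q k = k by apply: remgr_id.
  by rewrite (pairing_1r PA) ?Ap ?mul1r.
by rewrite (divgr_eq A B g) -/(p g) -/(q g) p1 q1 mulg1.
Qed.

Lemma exists_pairing G : abelian G -> exists B, pairing_on G B.
Proof.
case/abelian_structure=> b defG _; elim: b G defG => [|x b IHb] G.
  rewrite big_nil => <-; exists (fun _ _ => 1); split=> [||_ _ _ _|g /set1P] //=;
    by rewrite ?mulr1 ?oner_eq0.
rewrite big_cons => defG; have [[_ H _ defH] _ _ _] := dprodP defG.
rewrite defH in defG; have [bH /= bHP] := IHb H defH.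
have [bx bxP] := pairing_cycle x.
exact: pairing_dprod defG bxP bHP.
Qed.

End PairingExistence.

(** * Symmetric powers of a diagonalizable representation *)

(** The exponent vector of the monomial indexed by [f]: a complete invariant of [f] under
    permutation of the tensor factors. *)
Definition content (d m : nat) (f : 'I_d -> 'I_m) : 'X_{1..m} :=
  (\sum_(k < d) U_(f k))%MM.

Lemma content_perm d m (f : 'I_d -> 'I_m) (s : 'S_d) :
  content (fun k => f (s k)) = content f.
Proof. by rewrite /content [RHS](reindex_inj (@perm_inj _ s)). Qed.

Lemma contentE d m (f : 'I_d -> 'I_m) i :
  content f i = count_mem i [tuple f k | k < d].
Proof.
rewrite /content mnm_sumE -sum1_count big_tuple [RHS]big_mkcond /=.
by apply: eq_bigr => k _; rewrite mnm1E tnth_mktuple; case: eqP.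
Qed.

Lemma eq_content_perm d m (f h : 'I_d -> 'I_m) :
  content f = content h -> exists s : 'S_d, forall k, f k = h (s k).
Proof.
move=> eq_fh; have : perm_eq [tuple f k | k < d] [tuple h k | k < d].
  by apply/allP=> i _; rewrite /= -!contentE eq_fh.
case/tuple_permP=> s E; exists s => k.
by rewrite -[LHS](tnth_mktuple f) (val_inj E) !tnth_mktuple.
Qed.

Section TensorPower.

Variables (F : fieldType) (m d : nat).
Local Notation tens_index := {ffun 'I_d -> 'I_m}.
Implicit Types (f h : tens_index) (P Q : 'M[F]_m).

(** The Kronecker power of any matrix, so that base changes are covered too; [tens_mx] at [g] is
    convertible to the case [P = rG g]. *)
Definition tens_pow P : 'M[F]_#|tens_index| :=
  \matrix_(a, b) \prod_(k < d)
    P ((enum_val a : tens_index) k) ((enum_val b : tens_index) k).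

Lemma tens_powE P f h :
  tens_pow P (enum_rank f) (enum_rank h) = \prod_k P (f k) (h k).
Proof. by rewrite mxE !enum_rankK. Qed.

Lemma tens_powM P Q : tens_pow (P *m Q) = tens_pow P *m tens_pow Q.
Proof.
apply/matrixP=> a b; rewrite !mxE; under eq_bigr => k _ do rewrite mxE.
rewrite bigA_distr_bigA /= (reindex _ (onW_bij _ (@enum_val_bij _))) /=.
by apply: eq_bigr => c _; rewrite !mxE -big_split.
Qed.

Lemma tens_pow1 : tens_pow 1%:M = 1%:M.
Proof.
apply/matrixP=> a b; rewrite -(enum_valK a) -(enum_valK b) tens_powE.
set f := enum_val a; set h := enum_val b; rewrite mxE (inj_eq enum_rank_inj).
have [-> | /eqP neq_fh] := altP (f =P h).
  by rewrite big1 // => k _; rewrite mxE eqxx.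
have [k neq_k | eq_fh] := pickP (fun k => f k != h k).
  by rewrite (bigD1 k) //= mxE (negPf neq_k) mul0r.
by case: neq_fh; apply/ffunP=> k; apply/eqP/negbFE/eq_fh.
Qed.

Lemma tens_pow_unit P : P \in unitmx -> tens_pow P *m tens_pow (invmx P) = 1%:M.
Proof. by move=> uP; rewrite -tens_powM mulmxV // tens_pow1. Qed.

Lemma tens_basis_powE P f :
  tens_basis F f *m tens_pow P =
  \sum_(h : tens_index) (\prod_k P (f k) (h k)) *: tens_basis F h.
Proof.
rewrite -rowE; apply/rowP=> b; rewrite !mxE summxE (bigD1 (enum_val b)) //=.
rewrite !mxE enum_valK !eqxx mulr1 enum_rankK [X in _ + X]big1 ?addr0 // => h neq_hb.
by rewrite !mxE -(enum_valK b) (inj_eq enum_rank_inj) eq_sym (negPf neq_hb) mulr0.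
Qed.

Lemma sub_sym_rel f (s : 'S_d) :
  (tens_basis F f - tens_basis F [ffun k => f (s k)] <= sym_rel F m d)%MS.
Proof. by rewrite (sumsmx_sup f) // (sumsmx_sup s) // genmxE. Qed.

(** Applying [P] in every factor commutes with permuting the factors. *)
Lemma sym_relM P : (sym_rel F m d *m tens_pow P <= sym_rel F m d)%MS.
Proof.
rewrite {1}/sym_rel sumsmxMr; apply/sumsmx_subP=> f _.
rewrite sumsmxMr; apply/sumsmx_subP=> s _.
rewrite (eqmxMr _ (genmxE _)) mulmxBl !tens_basis_powE.
have bij_s : bijective (fun h : tens_index => [ffun k => h (s k)]).
  exists (fun h : tens_index => [ffun k => h ((s^-1)%g k)]) => h;
    by apply/ffunP=> k; rewrite !ffunE ?permK ?permKV.
rewrite [X in _ - X](reindex _ (onW_bij _ bij_s)) /= -sumrB.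
apply: summx_sub => h _.
rewrite [X in _ - X *: _](_ : _ = \prod_k P (f k) (h k)).
  by rewrite -scalerBr scalemx_sub // sub_sym_rel.
rewrite [RHS](reindex_inj (@perm_inj _ s)) /=.
by apply: eq_bigr => k _; rewrite !ffunE.
Qed.

(* The functional dual to the monomial [mu]; it kills [sym_rel], so monomials
   stay independent in the symmetric power. *)
Definition content_col (mu : 'X_{1..m}) : 'cV[F]_#|tens_index| :=
  \col_a (content (enum_val a : tens_index) == mu)%:R.

Lemma tens_basis_content_col f mu :
  tens_basis F f *m content_col mu = ((content f == mu)%:R)%:M.
Proof.
rewrite -rowE; apply/matrixP=> i j.
by rewrite !ord1 !mxE enum_rankK mulr1n.
Qed.

Lemma sym_rel_content_col mu : sym_rel F m d *m content_col mu = 0.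
Proof.
apply/sub_kermxP/sumsmx_subP=> f _; apply/sumsmx_subP=> s _.
rewrite genmxE; apply/sub_kermxP; rewrite mulmxBl !tens_basis_content_col.
suff -> : content [ffun k => f (s k)] = content f by rewrite subrr.
by rewrite -(content_perm f s); apply: eq_bigr => k _; rewrite ffunE.
Qed.

End TensorPower.

Section DiagonalSymPower.

Variables (F : fieldType) (gT : finGroupType) (G : {group gT}) (m d : nat).
Variables (rG : mx_representation F G m) (P : 'M[F]_m) (chi : 'I_m -> gT -> F).
Hypotheses (cardG_neq0 : #|G|%:R != 0 :> F) (uP : P \in unitmx).
Hypothesis chiM : forall i, {in G &, {morph chi i : g h / (g * h)%g >-> g * h}}.
Hypothesis chiP : forall g i, g \in G -> row i P *m rG g = chi i g *: row i P.

Local Notation tens_index := {ffun 'I_d -> 'I_m}.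
Local Notation W := (sym_rel F m d).

Definition invariant_index (f : tens_index) :=
  [forall g in G, \prod_k chi (f k) g == 1].

Definition invariant_contents : seq 'X_{1..m} :=
  undup [seq content f | f : tens_index in invariant_index].

(** The tensor product of the rows [f k] of [P], that is, of eigenvectors. *)
Let eigenvec (f : tens_index) : 'rV[F]_#|tens_index| := tens_basis F f *m tens_pow d P.

Let eigenvec_tens (f : tens_index) g : g \in G ->
  eigenvec f *m tens_repr rG d g = (\prod_k chi (f k) g) *: eigenvec f.
Proof.
move=> Gg; rewrite /eigenvec -mulmxA [tens_pow _ _ *m _](_ : _ = tens_pow d (P *m rG g)).
  rewrite !tens_basis_powE scaler_sumr; apply: eq_bigr => h _.
  rewrite scalerA -big_split; congr (_ *: _); apply: eq_bigr => k _ /=.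
  by have /rowP/(_ (h k)) := chiP (f k) Gg; rewrite -row_mul !mxE.
by rewrite tens_powM.
Qed.

Let eigenvec_content (f h : tens_index) : content f = content h ->
  in_factmod W (eigenvec f) = in_factmod W (eigenvec h).
Proof.
case/eq_content_perm=> s fE.
have {fE} -> : f = [ffun k => h (s k)] by apply/ffunP=> k; rewrite ffunE fE.
apply/esym/eqP; rewrite -subr_eq0 -linearB in_factmod_eq0 /= -mulmxBl.
exact: submx_trans (submxMr _ (sub_sym_rel _ _ _)) (sym_relM _ _).
Qed.

Let sum_chi (f : tens_index) :
  ~~ invariant_index f -> \sum_(g in G) \prod_k chi (f k) g = 0.
Proof.
rewrite negb_forall_in => /exists_inP[g0 Gg0 neq1].
apply: sum_character_eq0 Gg0 neq1 => g h Gg Gh.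
by rewrite -big_split; apply: eq_bigr => k _; rewrite chiM.
Qed.

(** Choosing one tensor of eigenvectors per invariant content gives a family [A]; its image in the
    quotient by [W] is a basis of the invariants. *)
Lemma rank_rfix_sym_repr :
  \rank (rfix_mx (sym_repr rG d) G) = size invariant_contents.
Proof.
set S := invariant_contents; set V := rfix_mx _ _.
have SP mu : mu \in S -> exists2 f, invariant_index f & content f == mu.
  by rewrite mem_undup => /imageP[f If ->]; exists f.
have ltS (i : 'I_(size S)) : nth 0%MM S i \in S by apply: mem_nth.
pose rep i := s2val (sig2W (SP _ (ltS i))).
have repI i : invariant_index (rep i) by rewrite /rep; case: (sig2W _).
have repE i : content (rep i) = nth 0%MM S i.
  by rewrite /rep; case: (sig2W _) => f /= _ /eqP.
pose A := \matrix_(i < size S) eigenvec (rep i).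
have freeA : \rank (in_factmod W A) = size S.
  apply/eqP; rewrite -[_ == _]/(row_free _) -kermx_eq0; set K := kermx _.
  (* A relation modulo [W] is carried by the inverse base change to one between basis tensors of
     distinct contents; the functionals [content_col] then read off its coefficients. *)
  have : (K *m A <= W)%MS.
    by rewrite -in_factmod_eq0 in_factmodE -mulmxA -in_factmodE mulmx_ker.
  clearbody K; move/(submxMr (tens_pow d (invmx P))).
  move/submx_trans/(_ (sym_relM _ _)) => sKW.
  apply/eqP/matrixP=> i j; rewrite [RHS]mxE.
  have /sub_kermxP := submx_trans sKW (introT sub_kermxP
    (sym_rel_content_col F d (nth 0%MM S j))).
  rewrite -!mulmxA (_ : A *m _ = delta_mx j (0 : 'I_1)).
    by rewrite -colE => /matrixP/(_ i 0); rewrite !mxE.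
  apply/row_matrixP=> l; rewrite row_mul rowK mulmxA /eigenvec.
  rewrite -[_ *m tens_pow d P *m _]mulmxA tens_pow_unit // mulmx1.
  rewrite tens_basis_content_col repE nth_uniq ?undup_uniq //.
  by apply/matrixP=> u v; rewrite !ord1 !mxE mulr1n eqxx andbT.
rewrite -freeA; apply/eqmx_rank/andP; split; last first.
  apply/rfix_mxP=> g Gg; rewrite -in_factmodJ //; congr (in_factmod _ _).
  apply/row_matrixP=> i; rewrite row_mul rowK eigenvec_tens //.
  by have /forall_inP/(_ g Gg)/eqP-> := repI i; rewrite scale1r.
(* [C] holds the coordinates, in the tensors of eigenvectors, of a lift of the invariants. *)
set X := V; pose Y := val_factmod X; pose C := Y *m tens_pow d (invmx P).
have XE : X = in_factmod W (C *m tens_pow d P).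
  by rewrite /C -mulmxA -tens_powM mulVmx // tens_pow1 mulmx1 val_factmodK.
have XG g : g \in G -> X *m sym_repr rG d g = X by apply: rfix_mxP.
(* Averaging over [G] kills the eigenvectors that are not invariant. *)
pose T := \sum_(g in G) tens_pow d P *m tens_repr rG d g.
have sumX : #|G|%:R *: X = in_factmod W (C *m T).
  rewrite /T mulmx_sumr linear_sum scaler_nat -sumr_const; apply: eq_bigr => g Gg.
  by rewrite -[LHS](XG g Gg) [in LHS]XE -in_factmodJ // mulmxA.
rewrite -(eqmx_scale _ cardG_neq0) sumX in_factmodE -mulmxA -in_factmodE.
apply: mulmx_sub; apply/row_subP=> a; rewrite in_factmodE row_mul -in_factmodE.
have -> : row a T = (\sum_(g in G) \prod_k chi ((enum_val a : tens_index) k) g)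
                      *: eigenvec (enum_val a).
  rewrite /T linear_sum scaler_suml; apply: eq_bigr => g Gg /=.
  by rewrite -eigenvec_tens // /eigenvec /tens_basis enum_valK -rowE -row_mul.
have [If | /sum_chi->] := boolP (invariant_index (enum_val a)); last first.
  by rewrite scale0r linear0 sub0mx.
rewrite linearZ scalemx_sub //=.
have Sa : content (enum_val a) \in S by rewrite mem_undup; apply: image_f.
have ia : (index (content (enum_val a)) S < size S)%N by rewrite index_mem.
have /eigenvec_content-> : content (enum_val a) = content (rep (Ordinal ia)).
  by rewrite repE nth_index.
rewrite -(rowK (fun i => eigenvec (rep i))) -/A.
by rewrite in_factmodE (in_factmodE _ A) -row_mul row_sub.
Qed.

End DiagonalSymPower.

(** * The regular representation and the permanent *)

Section PairingDiagonalization.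

Variables (F : numClosedFieldType) (gT : finGroupType).
Variables (G : {group gT}) (B : gT -> gT -> F).
Hypothesis PB : pairing_on G B.

Lemma pairing_prod n (b : 'I_n -> gT) h : (forall k, b k \in G) -> h \in G ->
  B (\prod_(k < n) b k)%g h = \prod_(k < n) B (b k) h.
Proof.
move=> Gb Gh; have [Bl _ _ _] := PB.
suff [] : B (\prod_(k < n) b k)%g h = \prod_(k < n) B (b k) h
          /\ (\prod_(k < n) b k)%g \in G by [].
apply: (big_ind2 (fun u v => B u h = v /\ u \in G)) => [|u u' v v' [<- Gu] [<- Gv] |//].
  by rewrite (pairing_1l PB).
by rewrite Bl // groupM.
Qed.

(** The summand is the character [B (g * h^-1)], nontrivial for distinct [g] and [h] by
    nondegeneracy. *)
Lemma pairing_orthogonality g h : g \in G -> h \in G ->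
  \sum_(k in G) B g k / B h k = (g == h)%:R * #|G|%:R.
Proof.
move=> Gg Gh; have [Bl Br B0 Bn] := PB; have [<-|neq_gh] := eqVneq.
  by rewrite mul1r -sumr_const; apply: eq_bigr => k Gk; rewrite divff ?B0.
have [k Gk neq1] : exists2 k, k \in G & B (g * h^-1)%g k != 1.
  apply/exists_inP; rewrite -negb_forall_in; apply: contra neq_gh => /forall_inP B1.
  rewrite eq_mulgV1; apply/eqP/Bn; first by rewrite groupM ?groupV.
  by move=> k /B1/eqP.
rewrite mul0r; apply: (sum_character_eq0 _ Gk) => [u v Gu Gv | ].
  by rewrite !Br // invfM mulrACA.
apply: contra neq1 => /eqP gh1; apply/eqP/(mulIf (B0 h k Gh Gk)).
rewrite -Bl ?groupM ?groupV // mulgKV mul1r.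
by rewrite -[LHS](divfK (B0 h k Gh Gk)) gh1 mul1r.
Qed.

Definition pairing_mx : 'M[F]_#|G| :=
  \matrix_(i, j) B (enum_val i) (enum_val j).

(** The inverse appears because [g] sends [e_h] to [e_(h g)], so the new coefficient at [h] is the
    old one at [h g^-1]. *)
Definition pairing_char (i : 'I_#|G|) (g : gT) : F := B (enum_val i) g^-1.

Lemma pairing_mx_unit : pairing_mx \in unitmx.
Proof.
pose Q : 'M[F]_#|G| := \matrix_(i, j) (#|G|%:R^-1 / B (enum_val j) (enum_val i)).
apply: (@mulmx1_unit _ _ pairing_mx Q _).1; apply/matrixP=> i j; rewrite !mxE.
transitivity (#|G|%:R^-1 * \sum_(k in G) B (enum_val i) k / B (enum_val j) k).
  rewrite big_distrr [RHS]big_enum_val /=.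
  by apply: eq_bigr => k _; rewrite !mxE mulrCA.
rewrite pairing_orthogonality ?enum_valP // (inj_eq enum_val_inj) mulrC mulfK //.
by rewrite pnatr_eq0 -lt0n cardG_gt0.
Qed.

Lemma pairing_mx_regular g i : g \in G ->
  row i pairing_mx *m regular_repr F G g = pairing_char i g *: row i pairing_mx.
Proof.
move=> Gg; apply/rowP=> k; rewrite !mxE; have [_ Br _ _] := PB.
have Gi := enum_valP i; have Gk := enum_valP k.
have Gkg : (enum_val k * g^-1)%g \in G by rewrite groupM ?groupV.
rewrite (bigD1 (gring_index G (enum_val k * g^-1)%g)) //= big1 => [|j neq_j].
  rewrite !mxE !gring_indexK // mulgKV gring_valK !eqxx mulr1 addr0.
  by rewrite Br ?groupV // mulrC.
rewrite !mxE /=; case: eqP => [kE | _]; last by rewrite mulr0.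
case/eqP: neq_j; rewrite kE gring_indexK ?groupM ?enum_valP //.
by rewrite mulgK gring_valK.
Qed.

(** The product of the characters at [g] is [B] of the product of the indices at [g^-1];
    nondegeneracy concludes. *)
Lemma pairing_invariant d (f : {ffun 'I_d -> 'I_#|G|}) :
  invariant_index G pairing_char f =
  (\prod_(k < d) (enum_val (f k) : gT) == 1)%g.
Proof.
have Gf k : enum_val (f k) \in G := enum_valP (f k).
have [_ _ _ Bn] := PB; apply/forall_inP/eqP => [inv_f | f1 g Gg].
  apply: Bn => [|g Gg]; first exact: group_prod.
  have /eqP := inv_f g^-1%g (groupVr Gg).
  by under eq_bigr do rewrite /pairing_char invgK; rewrite -pairing_prod.
by rewrite /pairing_char -pairing_prod ?groupV // f1 (pairing_1l PB) ?groupV.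
Qed.

End PairingDiagonalization.

Section CayleyPermanent.

Variables (F : numClosedFieldType) (gT : finGroupType) (G : {group gT}).
Variables (n : nat) (x : 'I_n -> gT).
Hypotheses (abG : abelian G) (cardG : #|G| = n).
Hypothesis (imx : G = [set x i | i : 'I_n] :> {set gT}).

Definition sum_index (s : 'S_n) (k : 'I_n) : 'I_#|G| :=
  gring_index G (x k * x (s k))%g.

(** Every permutation contributes a monomial with coefficient 1, so in characteristic 0 nothing
    cancels. *)
Lemma mcoeff_permanent mu :
  (permanent (cayley_mx F G x))@_mu = #|[pred s | content (sum_index s) == mu]|%:R.
Proof.
have -> : #|[pred s | content (sum_index s) == mu]| =
          (\sum_s (content (sum_index s) == mu))%N.
  by rewrite -[LHS]sum1_card big_mkcond; apply: eq_bigr => s _; rewrite inE; case: eqP.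
rewrite /permanent raddf_sum natr_sum; apply: eq_bigr => s _ /=.
rewrite (_ : \prod_(i < n) _ = 'X_[content (sum_index s)]).
  by rewrite mcoeffX.
rewrite /content (big_morph (fun mu => 'X_[mu]) (@mpolyXD _ F) (@mpolyX0 _ F)).
by apply: eq_bigr => k _; rewrite mxE.
Qed.

Let enum_x : enumerates G x.
Proof.
have xG i : x i \in G by rewrite imx imset_f.
split=> //; have /imset_injP : #|[set x i | i : 'I_n]| == #|'I_n|.
  by rewrite -imx cardG card_ord.
by move=> inj i j; apply: inj.
Qed.

(** The product is the square of the product of all [B (x k) g]. Since inversion permutes [G], one
    copy can be reordered to cancel the other factor by factor. *)
Lemma sum_index_invariant (B : gT -> gT -> F) (s : 'S_n) : pairing_on G B ->
  invariant_index G (pairing_char B) [ffun k => sum_index s k].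
Proof.
move=> PB; have [inj_x Gx] := enum_x; have [Bl _ _ _] := PB.
apply/forall_inP=> g' /groupVr; rewrite /pairing_char; move: g'^-1%g => {g'}g Gg.
under eq_bigr => k _ do rewrite ffunE gring_indexK ?groupM // Bl //.
rewrite big_split /= (_ : \prod_k B (x (s k)) g = \prod_k B (x k) g); last first.
  by rewrite [RHS](reindex_perm s).
have EV : enumerates G (fun k => (x k)^-1)%g.
  by split=> [k l /invg_inj/inj_x | k]; rewrite ?groupV.
have cardI : #|'I_n| = #|G| by rewrite card_ord.
have [t tE] := enumerates_transport cardI EV enum_x.
rewrite [X in _ * X](reindex_perm t) -big_split big1 //= => k _.
by rewrite tE -Bl ?groupV // mulgV (pairing_1l PB).
Qed.

(** One inclusion is [sum_index_invariant]; the other is Hall's theorem applied to the group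
    elements indexed by [f]. *)
Lemma msupp_permanent (B : gT -> gT -> F) : pairing_on G B ->
  msupp (permanent (cayley_mx F G x)) =i
  invariant_contents G n (pairing_char B).
Proof.
move=> PB mu; have [inj_x Gx] := enum_x.
rewrite mcoeff_msupp mcoeff_permanent pnatr_eq0 -lt0n mem_undup.
apply/card_gt0P/imageP => [[s] | [f]].
  rewrite inE => /eqP <-; exists [ffun k => sum_index s k].
    exact: sum_index_invariant.
  by apply: eq_bigr => k _; rewrite ffunE.
rewrite [_ \in _]pairing_invariant // => /eqP f1 ->.
have Gf k : enum_val (f k) \in G := enum_valP (f k).
have [s [r fr]] := hall_sum abG (esym cardG) enum_x Gf f1.
exists s; rewrite inE -(content_perm f r); apply/eqP/eq_bigr => k _.
by rewrite /sum_index -fr gring_valK.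
Qed.

Lemma num_monomials_permanent :
  num_monomials (permanent (cayley_mx F G x)) =
  \rank (rfix_mx (sym_repr (regular_repr F G) n) G).
Proof.
have [B PB] := exists_pairing F abG; have [_ Br _ _] := PB.
rewrite (rank_rfix_sym_repr n (P := pairing_mx G B) (chi := pairing_char B)).
- apply/perm_size/uniq_perm; rewrite ?msupp_uniq ?undup_uniq //.
  exact: msupp_permanent.
- by rewrite pnatr_eq0 -lt0n cardG_gt0.
- exact: pairing_mx_unit.
- move=> i g h Gg Gh; rewrite /pairing_char invMg Br ?groupV ?enum_valP //; exact: mulrC.
- move=> g i; exact: pairing_mx_regular.
Qed.

End CayleyPermanent.

Theorem theorem5p4 (R : realType) (gT : finGroupType) (G : {group gT})
    (n : nat) (x : 'I_n -> gT) :
  abelian G -> #|G| = n -> G = [set x i | i : 'I_n] :> {set gT} ->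
  num_monomials (permanent (cayley_mx R[i]%C G x)) =
  \rank (rfix_mx (sym_repr (regular_repr R[i]%C G) n) G).
Proof. exact: (@num_monomials_permanent R[i]%C). Qed.
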